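(* If $n$ is a power of an odd prime, then $\omega(\Gamma_{2,n})=\binom{n}{2}$.
   Context: $S_n$ is the symmetric group on $[n]=\{1,\dots,n\}$. A permutation $\sigma\in S_n$ is a $2$-derangement if there is no $2$-element subset $\{a,b\}\subseteq[n]$ with $\{\sigma(a),\sigma(b)\}=\{a,b\}$. Let $\mathcal{D}_{2,n}$ be the set of $2$-derangements in $S_n$. The $2$-derangement graph $\Gamma_{2,n}$ is the Cayley graph $\Gamma(S_n,\mathcal{D}_{2,n})$: vertices are the elements of $S_n$, and $u,v$ are adjacent iff $su=v$ for some $s\in\mathcal{D}_{2,n}$. $\omega(G)$ denotes the clique number of $G$. *)

(* Defs.v *)
From mathcomp Require Import all_boot all_fingroup.
Set Implicit Arguments.
Unset Strict Implicit.
Unset Printing Implicit Defensive.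

Definition is_clique (V : finType) (e : rel V) (C : {set V}) : bool :=
  [forall u in C, forall v in C, (u != v) ==> e u v].

Definition clique_number (V : finType) (e : rel V) : nat :=
  \max_(C : {set V} | is_clique e C) #|C|.

Definition cayley_graph (gT : finGroupType) (D : {set gT}) : rel gT :=
  [rel u v | [exists s in D, (s * u)%g == v]].

Definition is_2derangement (n : nat) (s : 'S_n) : bool :=
  ~~ [exists a : 'I_n, exists b : 'I_n,
        (a != b) && ([set s a; s b] == [set a; b])].

Definition derangements2 (n : nat) : {set 'S_n} :=
  [set s : 'S_n | is_2derangement s].

(* MathComp composes permutations left to right, (s * u) x = u (s x). As
   derangements2 n is closed under conjugation, the opposite convention gives
   the same adjacency relation. *)
Definition derangement_graph2 (n : nat) : rel 'S_n :=
  cayley_graph (derangements2 n).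

(* Main.v *)
(** If [s * u = v] and [s] stabilizes a pair [{a, b}], then [u] and [v] have the
    same image on [{a, b}]; so the members of a clique send a fixed pair to
    distinct pairs, which bounds a clique by ['C(n, 2)].  Conversely, identify
    the points with the field [F] of order [n] and pick one element of each pair
    [{a, - a}] of nonzero elements.  The [n (n - 1) / 2] maps [x |-> a x + b]
    with [a] among them form a clique: two such maps agreeing on a pair have
    slopes that are equal (if they agree pointwise) or opposite. *)
Require Import Defs.
From mathcomp Require Import all_boot all_fingroup.
From mathcomp Require Import all_algebra cyclic finfield ring.
Set Implicit Arguments.
Unset Strict Implicit.
Unset Printing Implicit Defensive.

Import GRing.Theory.

Lemma set2_eq (T : finType) (a b c d : T) :
  [set a; b] = [set c; d] -> (a = c /\ b = d) \/ (a = d /\ b = c).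
Proof.
move=> E.
have: a \in [set c; d] by rewrite -E set21.
have: b \in [set c; d] by rewrite -E set22.
have: c \in [set a; b] by rewrite E set21.
have: d \in [set a; b] by rewrite E set22.
by do 4 case/set2P=> ?; subst; auto.
Qed.

Lemma derangement_graph2P (n : nat) (u v : 'S_n) :
  reflect (forall a b : 'I_n, a != b -> [set u a; u b] != [set v a; v b])
          (derangement_graph2 u v).
Proof.
have imE (s : 'S_n) a b : u @: [set s a; s b] = [set (s * u)%g a; (s * u)%g b].
  by rewrite imsetU1 imset_set1 !permM.
apply: (iffP existsP) => [[s /andP[+ /eqP<-]] a b ab | uv].
  rewrite inE; apply: contra => /eqP E.
  apply/existsP; exists a; apply/existsP; exists b; rewrite ab /=.
  apply/eqP; apply: (imset_inj (@perm_inj _ u)).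
  by rewrite imE -E imsetU1 imset_set1.
exists (v * u^-1)%g; rewrite mulgKV eqxx andbT inE.
apply/negP => /existsP[a /existsP[b /andP[ab /eqP E]]].
have /negP[] := uv a b ab; apply/eqP.
by rewrite -[in RHS](mulgKV u v) -imE E imsetU1 imset_set1.
Qed.

Lemma clique_number_derangement_graph2_le (n : nat) :
  1 < n -> clique_number (@derangement_graph2 n) <= 'C(n, 2).
Proof.
case: n => [|[|n]] // _; apply/bigmax_leqP => C /forall_inP cliqueC.
(* The size [n.+2] makes [ord0] and [ord_max] distinct, so every value of [f] is a set of exactly
   two points. *)
pose f (s : 'S_n.+2) := [set s ord0; s ord_max].
have f_inj : {in C &, injective f}.
  move=> u v uC vC /eqP fuv; apply/eqP; apply: contraLR fuv => uv.
  have /forall_inP/(_ v vC)/implyP/(_ uv)/derangement_graph2P := cliqueC u uC.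
  exact.
rewrite -(card_in_imset f_inj) -[X in 'C(X, _)]card_ord -card_draws.
apply: subset_leq_card; apply/subsetP => _ /imsetP[s _ ->].
by rewrite inE cards2 (inj_eq perm_inj).
Qed.

(** Keep from each orbit [{x, f x}] the element of smaller [enum_rank]. With [f] the negation of a
    field, this selects the slopes. *)
Lemma half_transversal (T : finType) (D : {set T}) (f : T -> T) :
    involutive f -> (forall x, (f x \in D) = (x \in D)) ->
    {in D, forall x, f x != x} ->
  exists A : {set T}, [/\ A \subset D, {in A, forall x, f x \notin A}
                        & #|A|.*2 = #|D|].
Proof.
move=> fK fD fN.
pose A := [set x in D | enum_rank x < enum_rank (f x)].
exists A; split; first by apply/subsetP=> x; rewrite inE => /andP[].
  move=> x; rewrite !inE fK fD => /andP[-> /= lt_x].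
  by rewrite -leqNgt ltnW.
have f_inj := inv_inj fK.
(* The second copy of [#|A|] is counted as [#|f @: A|], and [f @: A] is the complement of [A] in
   [D]. *)
rewrite -addnn -{2}(card_imset (mem A) f_inj) -(cardsID A D); congr (_ + _).
  by apply: eq_card => x; rewrite !inE; case: (x \in D).
apply: eq_card => x; rewrite -{1}(fK x) (mem_imset _ _ f_inj) !inE fK fD.
case xD: (x \in D) => //=; rewrite ?andbF // andbT -leqNgt [RHS]leq_eqVlt.
have /negPf neq := fN x xD.
by rewrite (inj_eq val_inj) (inj_eq enum_rank_inj) neq.
Qed.

Section AffinePerm.

Variable F : finFieldType.

Local Open Scope ring_scope.

(* The slope [0] is replaced by [1] to make the map always bijective. *)
Definition affine_map (ab : F * F) (x : F) : F :=
  (if ab.1 == 0 then 1 else ab.1) * x + ab.2.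

Lemma affine_map_inj ab : injective (affine_map ab).
Proof.
rewrite /affine_map => x y /addIr /mulfI; apply.
by case: (eqVneq ab.1 0) => // _; exact: oner_neq0.
Qed.

Lemma affine_ord_inj ab :
  injective (fun i : 'I_#|F| => enum_rank (affine_map ab (enum_val i))).
Proof. by move=> i j /enum_rank_inj /affine_map_inj /enum_val_inj. Qed.

Definition affine_perm ab : 'S_#|F| := perm (@affine_ord_inj ab).

Lemma affine_permE (a b : F) i :
  a != 0 -> affine_perm (a, b) i = enum_rank (a * enum_val i + b).
Proof. by rewrite permE /affine_map /= => /negPf->. Qed.

Lemma affine_perm_set2_neq (a b c d : F) (i j : 'I_#|F|) :
    a != 0 -> c != 0 -> c != - a -> (a, b) != (c, d) -> i != j ->
  [set affine_perm (a, b) i; affine_perm (a, b) j]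
    != [set affine_perm (c, d) i; affine_perm (c, d) j].
Proof.
move=> a0 c0 ca abcd ij; apply/eqP; rewrite !affine_permE //.
set x := enum_val i; set y := enum_val j.
have xy0 : x - y != 0 by rewrite subr_eq0 (inj_eq enum_val_inj).
case/set2_eq=> -[/enum_rank_inj E1 /enum_rank_inj E2].
  (* Values matched in order: subtracting them gives [a = c], and then [E1] forces [b = d]. *)
  have E : a * (x - y) = c * (x - y).
    transitivity ((a * x + b) - (a * y + b)); first by ring.
    by rewrite E1 E2; ring.
  move: E1 abcd; rewrite (mulIf xy0 E) => /addrI->.
  by rewrite eqxx.
(* Values matched crosswise: the difference changes sign, so [c = - a]. *)
have E : c * (x - y) = - a * (x - y).
  transitivity ((c * x + d) - (c * y + d)); first by ring.
  by rewrite -E1 -E2; ring.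
by move: ca; rewrite (mulIf xy0 E) eqxx.
Qed.

Lemma clique_number_derangement_graph2_ge :
  odd #|F| -> ('C(#|F|, 2) <= clique_number (@derangement_graph2 #|F|))%N.
Proof.
move=> oddF.
have neg_neq : {in [set~ 0 : F], forall x, - x != x}.
  (* If [- x = x], then [x] is killed by 2 and, by Lagrange in the additive group, by the odd number
     [#|F|]; hence [x = 0]. *)
  move=> x; rewrite !inE; apply: contra => /eqP Nx.
  have x2 : x *+ 2 = 0 by rewrite mulr2n -{1}Nx addNr.
  have xq : x *+ #|F| = 0 by rewrite -cardsT -FinRing.zmodXgE expg_cardG ?inE.
  move/eqP: xq; rewrite -(odd_double_half #|F|) oddF -mul2n mulrnDr mulrnA.
  by rewrite x2 mul0rn addr0.
have oppD (x : F) : (- x \in [set~ 0]) = (x \in [set~ 0]).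
  by rewrite !inE oppr_eq0.
have [A [AD AN cardA]] := half_transversal (@opprK F) oppD neg_neq.
have A0 a : a \in A -> a != 0 by move/(subsetP AD); rewrite !inE.
(* A pair on which equal permutations would agree: it shows that no vertex is adjacent to itself, so
   [sep] yields injectivity. *)
have neq01 : enum_rank (1 : F) != enum_rank 0.
  by rewrite (inj_eq enum_rank_inj) oner_neq0.
pose P := setX A [set: F].
have sep u v : u \in P -> v \in P -> u != v ->
    derangement_graph2 (affine_perm u) (affine_perm v).
  case: u v => [a b] [c d]; rewrite !in_setX => /andP[aA _] /andP[cA _] uv.
  apply/derangement_graph2P => i j ij.
  apply: affine_perm_set2_neq => //; try exact: A0.
  by apply: contraTneq cA => ->; exact: AN.
have inj : {in P &, injective affine_perm}.
  move=> u v uP vP E; apply/eqP; apply: contraT => uv.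
  by have /derangement_graph2P/(_ _ _ neq01) := sep u v uP vP uv; rewrite E eqxx.
have -> : 'C(#|F|, 2) = #|affine_perm @: P|.
  rewrite (card_in_imset inj) cardsX cardsT bin2 mulnC.
  by rewrite -(cardsC1 (0 : F)) -cardA -doubleMl doubleK.
apply: (@leq_bigmax_cond _ (is_clique (@derangement_graph2 #|F|))
          (fun C : {set 'S_#|F|} => #|C|)).
apply/forall_inP => _ /imsetP[u uP ->]; apply/forall_inP => _ /imsetP[v vP ->].
by apply/implyP => uv; apply: sep => //; apply: contraNneq uv => ->.
Qed.

End AffinePerm.

Theorem theorem3 (n p k : nat) (p_prime : prime p) (p_odd : odd p)
    (k_gt0 : 0 < k) (n_eq : n = p ^ k) :
  clique_number (@derangement_graph2 n) = 'C(n, 2).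
Proof.
have [F _ cardF] := pPrimePowerField p_prime k_gt0.
(* Replacing the variable [n] by [#|F|] turns ['S_n] into the type of the affine permutations
   without any cast. *)
rewrite -cardF in n_eq; rewrite {}n_eq; apply/eqP; rewrite eqn_leq.
rewrite clique_number_derangement_graph2_le ?finNzRing_gt1 //=.
by apply: clique_number_derangement_graph2_ge; rewrite cardF oddX p_odd orbT.
Qed.
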